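(* Let Model 1 (the SDP relaxation) and Model 2 (the SDP determinant cut relaxation) be the two optimization problems in the variables $p^g_i,q^g_i,w_i$ ($i\in N$), $p_{ij},q_{ij}$ ($(i,j)\in E\cup E^r$) and $w^R_{ij},w^I_{ij}$ ($(i,j)\in E$) defined as follows. Both minimize $\sum_{i\in N}\left(c_i p^g_i + c'_i (p^g_i)^2\right)$ subject to the common constraints (a)--(f) listed in the context. In addition, Model 1 imposes $W\succeq 0$, where $W$ is the $n\times n$ Hermitian matrix built from the variables $w_i,w^R_{ij},w^I_{ij}$ as described in the context. Model 2 instead imposes $$\det(W_k)\ge 0,\qquad \forall k\in\{1,\dots,2^n-1\},$$ where $W_1,\dots,W_{2^n-1}$ are all the principal submatrices of $W$. Then Model 1 and Model 2 are strictly equivalent: they have the same objective function and the same feasible set (hence the same optimal value and the same optimal solutions).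
   Context: Data: a power network with finite node set $N$, $n=|N|\geq 1$, a set $E\subseteq N\times N$ of directed edges $(i,j)$ with $i\ne j$ (at most one of $(i,j),(j,i)$ lies in $E$), and $E^r=\{(j,i):(i,j)\in E\}$ the reversed edges. The following are given real constants: $g_{ij},b_{ij}$ (line parameters), $t_{ij}$ (thermal limits), lower and upper bounds $\underline p^g_i,\overline p^g_i,\underline q^g_i,\overline q^g_i,\underline v_i,\overline v_i$ (with $\underline v_i>0$), angle bounds $\underline\theta_{ij},\overline\theta_{ij}$ (at which $\tan$ is defined), demands $p^d_i,q^d_i$, and cost coefficients $c_i,c'_i$ (with the objective convex). The common constraints are: (a) $p_{ij}^2+q_{ij}^2\le t_{ij}$ for all lines, in both directions, i.e. for all $(i,j)\in E\cup E^r$; (b) $\underline p^g_i\le p^g_i\le\overline p^g_i$ and $\underline q^g_i\le q^g_i\le\overline q^g_i$ for all $i\in N$; (c) $p^g_i-p^d_i=\sum_{(i,j)\in E}p_{ij}$ and $q^g_i-q^d_i=\sum_{(i,j)\in E}q_{ij}$ for all $i\in N$; (d) $p_{ij}=g_{ij}w_i-g_{ij}w^R_{ij}-b_{ij}w^I_{ij}$ and $q_{ij}=-b_{ij}w_i+b_{ij}w^R_{ij}-g_{ij}w^I_{ij}$ for all $(i,j)\in E$; (e) $\underline v_i^2\le w_i\le\overline v_i^2$ for all $i\in N$; (f) $\tan(\underline\theta_{ij})\,w^R_{ij}\le w^I_{ij}\le\tan(\overline\theta_{ij})\,w^R_{ij}$ for all $(i,j)\in E$. The Hermitian $n\times n$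 matrix $W$, indexed by $N$, has entries $W_{ii}=w_i$ for $i\in N$; $W_{ij}=w^R_{ij}+\mathbf{i}\,w^I_{ij}$ and $W_{ji}=w^R_{ij}-\mathbf{i}\,w^I_{ij}$ for $(i,j)\in E$; and $W_{ij}=0$ for $i\neq j$ when neither $(i,j)$ nor $(j,i)$ is in $E$. Here $\mathbf i$ is the imaginary unit and $W\succeq0$ means $W$ is positive semidefinite. The principal submatrices of $W$ are the $2^n-1$ matrices obtained by keeping the rows and columns indexed by a nonempty subset of $N$ (the same subset for rows and columns). *)

(* Defs.v *)
(* On [R[i]], 0 <= z means that z is a nonnegative real. *)
From HB Require Import structures.
From mathcomp Require Import all_boot all_order all_algebra spectral.
From mathcomp Require Import complex.
From mathcomp Require Import all_classical all_reals all_analysis.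

Set Implicit Arguments.
Unset Strict Implicit.
Unset Printing Implicit Defensive.

Import Order.TTheory GRing.Theory Num.Theory.
Import numFieldNormedType.Exports.

Local Open Scope classical_set_scope.
Local Open Scope ring_scope.
Local Open Scope complex_scope.
Local Open Scope sesquilinear_scope.

Record opt_problem (R : realType) (X : Type) := OptProblem {
  objective : X -> R;
  feasible : set X
}.

Section OptProblem.
Variables (R : realType) (X : Type).
Implicit Types P Q : opt_problem R X.

(* +oo if the problem is infeasible, -oo if it is unbounded below *)
Definition optimal_value P : \bar R :=
  ereal_inf [set (objective P x)%:E | x in feasible P].

Definition optimal_solutions P : set X :=
  [set x | feasible P x /\
           forall y, feasible P y -> objective P x <= objective P y].

Definition strictly_equivalent P Q : Prop :=
  objective P = objective Q /\ feasible P = feasible Q.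

End OptProblem.

Definition psdmx (C : numClosedFieldType) (n : nat) (M : 'M[C]_n) : Prop :=
  M \is hermsymmx /\ forall x : 'cV[C]_n, 0 <= (x ^t* *m M *m x) 0 0.

(* A matrix indexed by a finite type [N] is a ['M_#|N|], the row of [i : N]
   being [enum_rank i]. *)
Definition principal_submx (T : Type) (N : finType) (M : 'M[T]_#|N|)
    (S : {set N}) : 'M[T]_#|S| :=
  let r := fun k : 'I_#|S| => enum_rank (enum_val k) in mxsub r r M.

Definition rev_edges (N : finType) (E : {set N * N}) : {set N * N} :=
  [set (e.2, e.1) | e in E]%SET.

Definition edge (N : finType) (E : {set N * N}) : Type :=
  {e : N * N | e \in E}.

Definition line (N : finType) (E : {set N * N}) : Type :=
  {e : N * N | e \in E :|: rev_edges E}.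

Lemma edge_line_subproof (N : finType) (E : {set N * N}) (e : edge E) :
  val e \in E :|: rev_edges E.
Proof. by rewrite finset.in_setU (valP e). Qed.

Definition edge_line (N : finType) (E : {set N * N}) (e : edge E) : line E :=
  exist _ (val e) (edge_line_subproof e).

Section Network.
Variables (R : realType) (N : finType).

Record network := Network {
  edges : {set N * N};
  line_g : edge edges -> R;
  line_b : edge edges -> R;
  thermal : line edges -> R;
  pg_lo : N -> R;  pg_hi : N -> R;
  qg_lo : N -> R;  qg_hi : N -> R;
  v_lo : N -> R;   v_hi : N -> R;
  theta_lo : edge edges -> R;
  theta_hi : edge edges -> R;
  pd : N -> R;
  qd : N -> R;
  cost_lin : N -> R;
  cost_quad : N -> R
}.

Variable D : network.

Record variables := Variables {
  pg : N -> R;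
  qg : N -> R;
  wnode : N -> R;
  pline : line (edges D) -> R;
  qline : line (edges D) -> R;
  wR : edge (edges D) -> R;
  wI : edge (edges D) -> R
}.

(* [R^o] is [R] seen as a module over itself, so that [N -> R^o] is a vector
   space on which [convex_function] applies. *)
Definition cost (x : N -> R^o) : R^o :=
  \sum_(i : N) (cost_lin D i * x i + cost_quad D i * x i ^+ 2).

Definition source (e : edge (edges D)) : N := (val e).1.

Definition common_constraints (x : variables) : Prop :=
  [/\ (forall l : line (edges D), pline x l ^+ 2 + qline x l ^+ 2 <= thermal l),
      (forall i : N, pg_lo D i <= pg x i <= pg_hi D i /\
                     qg_lo D i <= qg x i <= qg_hi D i),
      (* [pline] and [qline] of reversed edges occur in the first constraint only *)
      (forall i : N,
         pg x i - pd D i =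
           \sum_(e : edge (edges D) | source e == i) pline x (edge_line e) /\
         qg x i - qd D i =
           \sum_(e : edge (edges D) | source e == i) qline x (edge_line e)),
      (forall e : edge (edges D),
         pline x (edge_line e) =
           line_g e * wnode x (source e) - line_g e * wR x e - line_b e * wI x e /\
         qline x (edge_line e) =
           - line_b e * wnode x (source e) + line_b e * wR x e - line_g e * wI x e) &
      (forall i : N, v_lo D i ^+ 2 <= wnode x i <= v_hi D i ^+ 2) /\
      (forall e : edge (edges D),
         tan (theta_lo e) * wR x e <= wI x e <= tan (theta_hi e) * wR x e)].

Definition W_entry (x : variables) (i j : N) : R[i] :=
  if i == j then (wnode x i)%:C
  else if (insub (i, j) : option (edge (edges D))) is Some e
       then wR x e +i* wI x e
  else if (insub (j, i) : option (edge (edges D))) is Some e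
       then wR x e -i* wI x e
  else 0.

Definition Wmx (x : variables) : 'M[R[i]]_#|N| :=
  \matrix_(k, l) W_entry x (enum_val k) (enum_val l).

Definition sdp_model : opt_problem R variables :=
  OptProblem (fun x => cost (pg x))
    [set x | common_constraints x /\ psdmx (Wmx x)].

Definition det_model : opt_problem R variables :=
  OptProblem (fun x => cost (pg x))
    [set x | common_constraints x /\
             forall S : {set N}, S != finset.set0 ->
               0 <= \det (principal_submx (Wmx x) S)].

End Network.

(* Main.v *)
(* The two feasible sets agree by Sylvester's criterion for positive
   semidefiniteness.  A positive semidefinite principal submatrix has nonnegative
   eigenvalues, hence a nonnegative determinant.  Conversely, induct on the size
   of M = [[a, r], [r^*, B]].  If a = 0, the 2 x 2 minors through a force r = 0.
   If a > 0, M is congruent to diag(a, S) with S = B - r^* r / a, and each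
   principal minor of S is 1/a times a principal minor of M. *)
Require Import Defs.
From mathcomp Require Import all_boot all_order all_algebra.
From mathcomp Require Import perm spectral complex.
From mathcomp Require Import all_classical all_reals all_analysis.
Import Order.TTheory GRing.Theory Num.Theory.
Local Open Scope classical_set_scope.
Local Open Scope ring_scope.

Section Sylvester.
Set Implicit Arguments.
Unset Strict Implicit.
Unset Printing Implicit Defensive.
Local Open Scope sesquilinear_scope.
Context {C : numClosedFieldType}.

Lemma hermsymmx_entryP n (M : 'M[C]_n) :
  M \is hermsymmx <-> forall i j, M i j = (M j i)^*.
Proof.
rewrite is_hermitianmxE expr0 scale1r; split=> [/eqP/matrixP eM i j|eM].
  by rewrite {1}eM !mxE.
by apply/eqP/matrixP => i j; rewrite !mxE.
Qed.

Lemma trmxC_mul m n p (A : 'M[C]_(m, n)) (B : 'M[C]_(n, p)) :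
  (A *m B)^t* = B^t* *m A^t*.
Proof. by rewrite trmx_mul map_mxM. Qed.

Lemma psdmx_congr m n (P : 'M[C]_(m, n)) (M : 'M[C]_m) :
  psdmx M -> psdmx (P^t* *m M *m P).
Proof.
move=> [hM pM]; split.
  move: hM; rewrite !is_hermitianmxE !expr0 !scale1r => /eqP eM.
  by apply/eqP; rewrite !trmxC_mul trmxCK -eM mulmxA.
by move=> x; have := pM (P *m x); rewrite trmxC_mul !mulmxA.
Qed.

(** [mxsub f f M] is the congruence of [M] by the 0/1 matrix whose column [j] is the basis vector at
    [f j]; [f] may repeat indices. *)
Lemma psdmx_mxsub n k (f : 'I_k -> 'I_n) (M : 'M[C]_n) :
  psdmx M -> psdmx (mxsub f f M).
Proof.
move=> /(psdmx_congr (\matrix_(i, j) (i == f j)%:R)).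
congr psdmx; apply/matrixP => i j; rewrite !mxE (bigD1 (f j)) //= big1 => [|l lj].
  rewrite !mxE eqxx mulr1 addr0 (bigD1 (f i)) //= big1 => [|l li].
    by rewrite !mxE eqxx rmorph1 mul1r addr0.
  by rewrite !mxE (negPf li) rmorph0 mul0r.
by rewrite !mxE (negPf lj) mulr0.
Qed.

(** By the spectral theorem [M] is unitarily congruent to a diagonal matrix. That matrix is again
    positive semidefinite, so testing it on basis vectors shows every eigenvalue nonnegative, and
    [\det M] is their product. *)
Lemma psdmx_det_ge0 n (M : 'M[C]_n) : psdmx M -> 0 <= \det M.
Proof.
move=> psdM; have /hermitian_normalmx/orthomx_spectralP eM := psdM.1.
have := psdmx_congr ((spectralmx M)^t*) psdM.
move: eM; set P := spectralmx M; set d := spectral_diag M => eM.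
have uP : P \is unitarymx := spectral_unitarymx M.
have PP : P *m P^t* = 1%:M by apply/unitarymxP.
rewrite trmxCK {1}eM invmx_unitary // !mulmxA PP mul1mx -mulmxA PP mulmx1.
move=> [_ pd].
rewrite eM !det_mulmx mulrAC -det_mulmx mulVmx ?spectral_unit // det1 mul1r.
rewrite det_diag; apply: prodr_ge0 => i _.
have := pd (delta_mx i 0); rewrite trmx_delta map_delta_mx -rowE row_diag_mx.
rewrite -scalemxAl mul_delta_mx mxE.
by rewrite mxE !eqxx mulr1.
Qed.

Lemma psdmx_block_diag n (a : C) (S : 'M[C]_n) :
  0 <= a -> psdmx S -> psdmx (block_mx a%:M 0 0 S : 'M[C]_(1 + n)).
Proof.
move=> a0 [hS pS]; split.
  move: hS; rewrite !is_hermitianmxE !expr0 !scale1r => /eqP eS.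
  rewrite tr_block_mx map_block_mx -eS !trmx0 !map_mx0 tr_scalar_mx map_scalar_mx.
  by rewrite /= geC0_conj.
move=> x; rewrite -[x]vsubmxK tr_col_mx map_row_mx mul_row_block mul_row_col.
rewrite !mulmx0 addr0 add0r mxE; apply: addr_ge0; last exact: pS.
rewrite mul_mx_scalar -scalemxAl mxE; apply: mulr_ge0 => //.
by rewrite mxE big_ord1 !mxE mulrC mul_conjC_ge0.
Qed.

(** One step of Gaussian elimination with pivot [a], applied to rows and columns at once. As [L] is
    unitriangular, it preserves determinants too. *)
Lemma block_mx_schur n (a : C) (r : 'rV[C]_n) (B : 'M[C]_n) (a_gt0 : 0 < a) :
  let L := block_mx 1%:M (a^-1 *: r) 0 1%:M : 'M[C]_(1 + n) in
  block_mx a%:M r (r^t*) B =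
  L^t* *m block_mx a%:M 0 0 (B - a^-1 *: (r^t* *m r)) *m L.
Proof.
have a0 : a != 0 by rewrite gt_eqF.
rewrite /= tr_block_mx map_block_mx !trmx0 !map_mx0 !trmx1 !map_mx1.
rewrite !mulmx_block !(mul0mx, mulmx0, mul1mx, mulmx1, addr0, add0r).
rewrite mul_scalar_mx scalerA mulfV // scale1r.
rewrite linearZ /= map_mxZ fmorphV /= geC0_conj ?ltW // mul_mx_scalar scalerA.
by rewrite mulfV // scale1r -scalemxAr addrC subrK.
Qed.

Lemma det_block_mx_schur n (a : C) (r : 'rV[C]_n) (B : 'M[C]_n) : 0 < a ->
  \det (block_mx a%:M r (r^t*) B) = a * \det (B - a^-1 *: (r^t* *m r)).
Proof.
move=> a0; rewrite block_mx_schur // !det_mulmx tr_block_mx map_block_mx.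
rewrite trmx0 map_mx0 !trmx1 !map_mx1 det_lblock !det_ublock !det1 det_scalar1.
by rewrite !mul1r !mulr1.
Qed.

(* A non-injective [f] only adds the vacuous condition 0 <= 0. *)
Lemma psdmx_of_minors_ge0 n (M : 'M[C]_n) : M \is hermsymmx ->
  (forall k (f : 'I_k -> 'I_n), 0 <= \det (mxsub f f M)) -> psdmx M.
Proof.
elim: n M => [|n IHn] M hM minM.
  by split=> // x; rewrite mxE big_ord0.
pose a := M 0 0; pose r : 'rV[C]_n := @ursubmx _ 1 n 1 n M.
pose B : 'M[C]_n := @drsubmx _ 1 n 1 n M.
have /hermsymmx_entryP eM := hM.
have eMB : M = block_mx a%:M r (r^t*) B :> 'M[C]_(1 + n).
  rewrite -[LHS](@submxK _ 1 n 1 n); congr block_mx.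
    rewrite [LHS]mx11_scalar; congr _%:M; rewrite !mxE.
    by congr (M _ _); apply: val_inj.
  by apply/matrixP => i j; rewrite !mxE eM.
(* [ext k f] puts index 0 in front of the selection [f], so that the selected submatrix of [M] keeps
   the pivot [a]. *)
pose ext k (f : 'I_k -> 'I_n) (i : 'I_(1 + k)) : 'I_(1 + n) :=
  match fintype.split i with inl i0 => lshift n i0 | inr j => rshift 1 (f j) end.
have extE k (f : 'I_k -> 'I_n) : mxsub (ext k f) (ext k f) M =
    block_mx a%:M (colsub f r) ((colsub f r)^t*) (mxsub f f B) :> 'M[C]_(1 + k).
  rewrite eMB; apply/matrixP => i j; rewrite mxE /ext.
  by case: (split_ordP i) => i' ->; case: (split_ordP j) => j' ->;
    rewrite ?(unsplitK (inl _)) ?(unsplitK (inr _)) ?block_mxEul ?block_mxEur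
      ?block_mxEdl ?block_mxEdr ?mxE.
have minB k (f : 'I_k -> 'I_n) : 0 <= \det (mxsub f f B).
  have := minM k (fun i => rshift 1 (f i)).
  by congr (0 <= \det _); apply/matrixP => i j; rewrite !mxE.
have a_ge0 : 0 <= a.
  by have := minM 1%N (fun=> 0); rewrite det_mx11 mxE.
have hB : B \is hermsymmx by apply/hermsymmx_entryP => i j; rewrite !mxE.
have [a0|a_neq0] := eqVneq a 0.
  have r0 : r = 0.
    apply/rowP => j; rewrite !mxE; set j' := rshift 1 j.
    (* With [a = 0] the minor on indices 0 and [j'] equals minus the squared modulus of [M 0 j']. *)
    have := minM _ (fun i : 'I_2 => if i == 0 then lshift n 0 else j').
    rewrite (expand_det_row _ 0) big_ord_recl big_ord1 /cofactor !det_mx11 !mxE /=.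
    rewrite (_ : lshift n 0 = 0); last exact: val_inj.
    rewrite -/a a0 mul0r add0r expr1 mulN1r mulrN oppr_ge0 [M j' 0]eM -normCK.
    by rewrite real_exprn_even_le0 ?normr_real //= normr_eq0 => /eqP.
  rewrite eMB r0 trmx0 map_mx0; apply: psdmx_block_diag => //.
  exact: IHn.
have a_gt0 : 0 < a by rewrite lt_def a_neq0.
rewrite eMB block_mx_schur //; apply/psdmx_congr/psdmx_block_diag => //.
apply: IHn.
  apply/hermsymmx_entryP => i j; rewrite !mxE !big_ord1 !mxE.
  rewrite rmorphB !rmorphM fmorphV /= conjCK (geC0_conj a_ge0).
  by rewrite [M (rshift 1 i) _]eM [X in _ = _ - _ * X]mulrC.
(* Eliminating the pivot commutes with selecting along [f]: the minor of [M] along [ext k f] is [a]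
   times that of the Schur complement along [f]. *)
move=> k f; have := minM _ (ext k f).
rewrite extE det_block_mx_schur // pmulr_rge0 //.
congr (0 <= \det _); apply/matrixP => i j; rewrite !mxE.
by rewrite !big_ord1 !mxE.
Qed.

(** Here [f] is a permutation, whose sign enters once for the rows and once for the columns and so
    cancels. *)
Lemma det_mxsub_perm k m (A : 'M[C]_m) (f : 'I_k -> 'I_m) :
  injective f -> k = m -> \det (mxsub f f A) = \det A.
Proof.
move=> f_inj km; case: m / km A f f_inj => A f f_inj.
have -> : mxsub f f A = row_perm (perm f_inj) (col_perm (perm f_inj) A).
  by apply/matrixP => i j; rewrite !mxE !permE.
rewrite row_permE col_permE !det_mulmx !det_perm odd_permV.
by rewrite mulrCA -expr2 sqrr_sign mulr1.
Qed.

Lemma psdmx_principal_minorsP (N : finType) (M : 'M[C]_#|N|) :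
  psdmx M <-> M \is hermsymmx /\
    forall S : {set N}, S != finset.set0 -> 0 <= \det (principal_submx M S).
Proof.
split=> [psdM|[hM minM]].
  split=> [|S _]; first exact: psdM.1.
  exact/psdmx_det_ge0/psdmx_mxsub.
apply: psdmx_of_minors_ge0 => // k f.
have [/injectiveP f_inj|/injectivePn[i [j ij fij]]] := boolP (injectiveb f); last first.
  by rewrite (determinant_alternate ij) // => l; rewrite !mxE fij.
(* The empty minor is 1; otherwise [ord0] witnesses that the image [S] below is nonempty. *)
case: k f f_inj => [|k] f f_inj; first by rewrite det_mx00.
pose g i := enum_val (f i).
have g_inj : injective g by move=> i j /enum_val_inj/f_inj.
pose S := [set g i | i in 'I_k.+1]%SET.
have gS i : g i \in S by apply: imset_f.
(* The enumeration of [S] need not follow the order of [f]; [h] is the reindexing between the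
   two. *)
pose h i := enum_rank_in (gS ord0) (g i).
have hE i : enum_val (h i) = g i by rewrite /h enum_rankK_in.
have -> : mxsub f f M = mxsub h h (principal_submx M S).
  by apply/matrixP => i j; rewrite !mxE !hE /g !enum_valK.
rewrite det_mxsub_perm.
- by apply: minM; apply/set0Pn; exists (g ord0).
- by move=> i j /(congr1 enum_val); rewrite !hE => /g_inj.
- by rewrite card_imset ?card_ord.
Qed.

End Sylvester.

(** If both [(i, j)] and [(j, i)] were edges, the two mirrored entries would come from unrelated
    variables; orientation excludes this case. *)
Lemma Wmx_hermsymmx (R : realType) (N : finType) (D : network R N)
    (E_oriented : forall i j : N, (i, j) \in edges D ->
                    i != j /\ (j, i) \notin edges D)
    (x : variables D) : Wmx x \is hermsymmx.
Proof.
apply/hermsymmx_entryP => k l; rewrite !mxE /W_entry.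
move: (enum_val k) (enum_val l) => i j {k l}; rewrite [j == i]eq_sym.
case: eqVneq => [<-|ij]; first exact/esym/conjc_real.
pose Esub := [the subType _ of {e : N * N | e \in edges D}].
case: (@insubP _ _ Esub (i, j)) => [e ije _|_];
  case: (@insubP _ _ Esub (j, i)) => [e' jie _|_].
- by have [_ /negP[]] := E_oriented _ _ ije.
- by apply/esym; apply: (conjcK (wR x e +i* wI x e)%C).
- by [].
- by rewrite rmorph0.
Qed.

Theorem theorem1 (R : realType) (N : finType) (D : network R N)
    (N_gt0 : (0 < #|N|)%N)
    (E_oriented : forall i j : N, (i, j) \in edges D ->
                    i != j /\ (j, i) \notin edges D)
    (v_lo_gt0 : forall i : N, 0 < v_lo D i)
    (tan_defined : forall e : edge (edges D),
                     cos (theta_lo e) != 0 /\ cos (theta_hi e) != 0)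
    (cost_convex : convex_function [set: N -> R^o] (@cost R N D)) :
  [/\ strictly_equivalent (sdp_model D) (det_model D),
      optimal_value (sdp_model D) = optimal_value (det_model D) &
      optimal_solutions (sdp_model D) = optimal_solutions (det_model D)].
Proof.
(* The models share their objective, so equal feasible sets make them equal as records and all three
   claims become reflexive. *)
have -> : det_model D = sdp_model D; last by [].
congr OptProblem; apply/seteqP; split=> x /= [cx mx]; split=> //.
  by apply/psdmx_principal_minorsP; split=> //; apply: Wmx_hermsymmx.
by have /psdmx_principal_minorsP[] := mx.
Qed.
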